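(* For $n\geq 1$, $$\sum_{\sigma\in \mathfrak{D}_n}q^{\operatorname{inv}\sigma}t^{\operatorname{exc} \sigma}=\sum_{0\leq k\leq n/2} \Big(\sum_{\sigma\in \mathrm{DE}_{n,k}}q^{\operatorname{inv}\sigma}\Big) t^k (1+t)^{n-2k}.$$
   Context: $\mathfrak{S}_n$ is the set of permutations of $[n]=\{1,\dots,n\}$ and $\mathfrak{D}_n\subseteq\mathfrak{S}_n$ is the set of derangements (permutations with no fixed point $\sigma(i)=i$). $\operatorname{exc}\sigma=\#\{i\in[n]: i<\sigma(i)\}$ and $\operatorname{inv}\sigma=\#\{(i,j): i<j,\ \sigma(i)>\sigma(j)\}$. $\operatorname{cda}\sigma$ (number of cyclic double ascents, or double excedances) is the number of $i\in[n]$ with $i<\sigma(i)<\sigma^2(i)$. $\mathrm{DE}_{n,k}=\{\sigma\in\mathfrak{D}_n:\operatorname{exc}\sigma=k,\ \operatorname{cda}\sigma=0\}$. *)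

(* Defs.v *)
From mathcomp Require Import all_boot all_fingroup all_algebra.

Set Implicit Arguments.
Unset Strict Implicit.
Unset Printing Implicit Defensive.

(* Permutations of [n] are 'S_n, acting on 'I_n = {0, ..., n-1}; shifting the
   indices by one preserves all the order comparisons below. *)

Definition derangements (n : nat) : {set 'S_n} :=
  [set s : 'S_n | [forall i : 'I_n, s i != i]].

Definition exc (n : nat) (s : 'S_n) : nat :=
  #|[set i : 'I_n | i < s i]|.

Definition invs (n : nat) (s : 'S_n) : nat :=
  #|[set ij : 'I_n * 'I_n | (ij.1 < ij.2) && (s ij.1 > s ij.2)]|.

(* cyclic double ascents, a.k.a. double excedances *)
Definition cda (n : nat) (s : 'S_n) : nat :=
  #|[set i : 'I_n | i < s i < s (s i)]|.

Definition DE (n k : nat) : {set 'S_n} :=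
  [set s in derangements n | (exc s == k) && (cda s == 0)].

(* Main.v *)
(* Call an index a valley, double ascent, peak or double descent according to
   whether it is an excedance position and whether it is an excedance value. A
   derangement thus determines a word in four letters, and the derangements with
   a given word (a Laguerre history) are the permutations supported on a board:
   every letter opens or closes a row (position) and a column (value), and a row
   may be matched with a column if one of them opens before the other closes.
   The open lines are indistinguishable, so that closing a column amounts to
   matching it with any one of the open rows and deleting the pair, which
   contributes to q^inv a factor independent of the rest of the board. At equal
   numbers h of open rows and columns, a double ascent and a double descent
   contribute the same factor q^h [h]_q and preserve h. Hence turning all double
   ascents into double descents preserves the sum of q^inv over a word, and
   every double descent of a word without double ascents accounts for a factor
   1 + t. Such a word of length n with k excedances has n - 2k double
   descents. *)

Require Import Defs.
From mathcomp Require Import all_boot all_fingroup all_algebra.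
From mathcomp Require Import zify.

Set Implicit Arguments.
Unset Strict Implicit.
Unset Printing Implicit Defensive.

Import GRing.Theory.

Local Open Scope ring_scope.

Lemma lift_perm_inj n (i j : 'I_n.+1) : injective (lift_perm i j).
Proof.
move=> s s' eqs; apply/permP=> k; apply: (@lift_inj _ j).
by rewrite -!(lift_perm_lift i) eqs.
Qed.

Lemma lift_perm_onto n (i j : 'I_n.+1) (s : 'S_n.+1) :
  s i = j -> exists s', s = lift_perm i j s'.
Proof.
move=> si; have /fin_all_exists[f sE] k : exists l, s (lift i k) = lift j l.
  have: j != s (lift i k) by rewrite -si (inj_eq perm_inj) neq_lift.
  by case/unlift_some=> l -> _; exists l.
have f_inj : injective f.
  by move=> k l eqkl; apply/(@lift_inj _ i)/(@perm_inj _ s); rewrite !sE eqkl.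
exists (perm f_inj); apply/permP=> x; case: (unliftP i x) => [k|] ->.
  by rewrite lift_perm_lift permE sE.
by rewrite lift_perm_id.
Qed.

Lemma big_lift_perm (A : Type) (idx : A) (op : Monoid.com_law idx) n
    (i j : 'I_n.+1) (P : pred 'S_n.+1) (F : 'S_n.+1 -> A) :
  \big[op/idx]_(s | P s && (s i == j)) F s =
  \big[op/idx]_(s : 'S_n | P (lift_perm i j s)) F (lift_perm i j s).
Proof.
rewrite -[RHS](big_imset _ (in2W (@lift_perm_inj _ i j))) /=.
apply: eq_bigl => s; apply/andP/imsetP => [[Ps /eqP s_ij] | [s' Ps' ->]].
  have [s' eqs] := lift_perm_onto s_ij.
  by exists s'; rewrite // unfold_in -eqs.
by rewrite lift_perm_id.
Qed.

Lemma invsE n (s : 'S_n) :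
  invs s = (\sum_(i < n) \sum_(j < n) ((i < j) && (s j < s i)))%N.
Proof.
rewrite /invs -sum1dep_card big_mkcond /= pair_big /=.
by apply: eq_bigr => -[i j] _ /=; case: ifP.
Qed.

Lemma invsV n (s : 'S_n) : invs s^-1%g = invs s.
Proof.
rewrite !invsE exchange_big (reindex_inj (@perm_inj _ s)).
apply: eq_bigr => i _; rewrite (reindex_inj (@perm_inj _ s)).
by apply: eq_bigr => j _; rewrite !permK andbC.
Qed.

Lemma invs_lift_perm n (i j : 'I_n.+1) (s : 'S_n) :
  invs (lift_perm i j s) =
  (\sum_(k < n) ((i <= k) && (s k < j)) + \sum_(k < n) ((k < i) && (j <= s k))
   + invs s)%N.
Proof.
rewrite !invsE (bigD1_ord i) //= (bigD1_ord i) //= ltnn add0n -addnA.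
congr (_ + _)%N; last rewrite -big_split /=; apply: eq_bigr => k _.
  rewrite lift_perm_id lift_perm_lift /= /bump; lia.
rewrite (bigD1_ord i) //= lift_perm_id lift_perm_lift /=.
congr (_ + _)%N; first by rewrite /bump; lia.
by apply: eq_bigr => l _; rewrite lift_perm_lift /= /bump; lia.
Qed.

Lemma sum_ltn_ord n m : (m <= n -> \sum_(k < n) (k < m) = m)%N.
Proof.
move=> lemn; rewrite -big_mkcond -(big_ord_widen _ (fun=> 1%N)) //.
by rewrite sum1_card card_ord.
Qed.

Lemma invs_lift_perm_corner n (i j : 'I_n.+1) (s : 'S_n) :
    (forall k : 'I_n, (k < i)%N -> (j <= s k)%N) ->
  invs (lift_perm i j s) = (i + j + invs s)%N.
Proof.
move=> corner; rewrite invs_lift_perm [(i + j)%N]addnC; congr (_ + _ + _)%N.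
  rewrite -[RHS](sum_ltn_ord (leq_ord j)) [RHS](reindex_inj (@perm_inj _ s)).
  by apply: eq_bigr => k _; have := corner k; lia.
rewrite -[RHS](sum_ltn_ord (leq_ord i)).
by apply: eq_bigr => k _; have := corner k; lia.
Qed.

Definition minor (i j : nat) (B : rel nat) : rel nat :=
  fun x y => B (bump i x) (bump j y).

Definition on_board n (B : rel nat) (s : 'S_n) : bool :=
  [forall x : 'I_n, B x (s x)].

Lemma on_board_lift_perm n B (i j : 'I_n.+1) (s : 'S_n) :
  on_board B (lift_perm i j s) = B i j && on_board (minor i j B) s.
Proof.
apply/forallP/andP => [Bs | [Bij /forallP Bs] x].
  split; first by have := Bs i; rewrite lift_perm_id.
  by apply/forallP=> x; have := Bs (lift i x); rewrite lift_perm_lift.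
case: (unliftP i x) => [y|] ->; last by rewrite lift_perm_id.
by rewrite lift_perm_lift; apply: Bs.
Qed.

Lemma unbump_lt h k : (k < h)%N -> unbump h k = k.
Proof. by move=> ltkh; rewrite /unbump ltnNge (ltnW ltkh) subn0. Qed.

Lemma unbumpS h k : unbump h.+1 k.+1 = (unbump h k).+1.
Proof. rewrite /unbump; lia. Qed.

Lemma unbump_addS h k : unbump h (h + k.+1) = (h + k)%N.
Proof. rewrite /unbump; lia. Qed.

Lemma addnS_eqF h k : (h + k.+1 == h)%N = false.
Proof. lia. Qed.

Variant event := OpenRow | OpenCol | CloseRow | CloseCol.

Definition event_tr (e : event) : event :=
  match e with
  | OpenRow => OpenCol | OpenCol => OpenRow
  | CloseRow => CloseCol | CloseCol => CloseRow
  end.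

(* [board r c es] has r open rows and c open columns, followed by the lines that
   [es] opens or closes, in this order. A cell is allowed if one of its lines
   opens before the other one closes. *)
Fixpoint board (r c : nat) (es : seq event) (x y : nat) : bool :=
  match es with
  | [::] => false
  | OpenRow :: es' => board r.+1 c es' x y
  | OpenCol :: es' => board r c.+1 es' x y
  | CloseRow :: es' => if x == r then y < c else board r c es' (unbump r x) y
  | CloseCol :: es' => if y == c then x < r else board r c es' x (unbump c y)
  end%N.

Lemma board_tr r c es x y :
  board c r (map event_tr es) y x = board r c es x y.
Proof. by elim: es r c x y => [|[] es IHes] r c x y //=; rewrite IHes. Qed.

Lemma board_corner r c es x y :
  (x < r)%N -> (y < c)%N -> board r c es x y = false.
Proof.
elim: es r c => [|[] es IHes] r c ltxr ltyc //=.
- by rewrite IHes // leqW.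
- by rewrite IHes // leqW.
- by rewrite ltn_eqF // unbump_lt ?IHes.
- by rewrite ltn_eqF // unbump_lt ?IHes.
Qed.

Lemma board_open_row r c es x x' y :
  (x < r)%N -> (x' < r)%N -> board r c es x y = board r c es x' y.
Proof.
elim: es r c y => [|[] es IHes] r c y ltx ltx' //=.
- by apply: IHes; apply: leqW.
- exact: IHes.
- by rewrite !ltn_eqF // !unbump_lt //; apply: IHes.
- by rewrite ltx ltx' (IHes r c (unbump c y)).
Qed.

Lemma board_drop_row r c es x y : board r.+1 c es x.+1 y = board r c es x y.
Proof.
elim: es r c x y => [|[] es IHes] r c x y //=; rewrite ?ltnS ?IHes //.
by rewrite eqSS unbumpS IHes.
Qed.

(* The letter of an index tells whether it is an excedance position and whether
   it is an excedance value. *)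
Definition letter : finType := (bool * bool)%type.

Local Notation double_ascent := (true, true).
Local Notation valley := (true, false).
Local Notation peak := (false, true).
Local Notation double_descent := (false, false).

(* Closing lines before opening others rules out fixed points. *)
Definition letter_events (a : letter) : seq event :=
  match a with
  | double_ascent => [:: CloseCol; OpenRow]
  | valley => [:: OpenRow; OpenCol]
  | peak => [:: CloseCol; CloseRow]
  | double_descent => [:: CloseRow; OpenCol]
  end.

Definition events (w : seq letter) : seq event :=
  flatten [seq letter_events a | a <- w].

Definition fits (w : seq letter) (x y : nat) : bool :=
  if (nth valley w x).1 then (x < y)%N && (nth valley w y).2
  else (y < x)%N && ~~ (nth valley w y).2.

Lemma board_events_open_row r c w x y : (x < r)%N ->
  board r c (events w) x (c + y) = (nth valley w y).2.
Proof.
elim: w r c y => [|[[] []] w IHw] r c [|y] ltxr //=.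
- by rewrite addn0 eqxx.
- by rewrite addnS_eqF unbump_addS IHw // ltnW.
- by rewrite board_corner ?addn0 // leqW.
- by rewrite -addSnnS IHw // leqW.
- by rewrite addn0 eqxx.
- by rewrite addnS_eqF unbump_addS (ltn_eqF ltxr) unbump_lt ?IHw.
- by rewrite ltn_eqF // unbump_lt // board_corner // addn0.
- by rewrite ltn_eqF // unbump_lt // -addSnnS IHw.
Qed.

Lemma board_events_open_col r c w x y : (y < c)%N ->
  board r c (events w) (r + x) y = ~~ (nth valley w x).1.
Proof.
elim: w r c x => [|[[] []] w IHw] r c [|x] ltyc //=.
- by rewrite ltn_eqF // unbump_lt // board_corner // addn0.
- by rewrite ltn_eqF // unbump_lt // -addSnnS IHw.
- by rewrite board_corner ?addn0 // leqW.
- by rewrite -addSnnS IHw // leqW.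
- by rewrite ltn_eqF // unbump_lt // addn0 eqxx.
- by rewrite ltn_eqF // unbump_lt // addnS_eqF unbump_addS IHw.
- by rewrite addn0 eqxx.
- by rewrite addnS_eqF unbump_addS IHw // ltnW.
Qed.

Lemma board_events r c w x y :
  board r c (events w) (r + x) (c + y) = fits w x y.
Proof.
elim: w r c x y => [|a w IHw] r c x y; first by rewrite /= /fits !nth_nil andbF.
rewrite -[events _]/(letter_events a ++ events w).
case: a x y => [[] []] [|x] [|y]; rewrite /fits /= ?if_same;
  rewrite ?addn0 ?eqxx ?addnS_eqF ?unbump_addS ?ltnn;
  rewrite ?[(_ + _ < _)%N]ltnNge ?leq_addr //.
- by rewrite board_events_open_row.
- by rewrite -addSnnS; apply: IHw.
- by rewrite board_corner.
- by rewrite -addSnnS; apply: board_events_open_row.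
- by rewrite -addSnnS; apply: board_events_open_col.
- by rewrite -!addSnnS; apply: IHw.
- by rewrite board_events_open_col.
- by rewrite -addSnnS; apply: IHw.
Qed.

Definition cyc_word n (s : 'S_n) : n.-tuple letter :=
  [tuple (i < s i, s^-1%g i < i)%N | i < n].

Lemma nth_cyc_word n (s : 'S_n) (i : 'I_n) :
  nth valley (cyc_word s) i = ((i < s i)%N, (s^-1%g i < i)%N).
Proof. by rewrite -tnth_nth tnth_mktuple. Qed.

Lemma on_board_fits n (s : 'S_n) (w : n.-tuple letter) :
  on_board (fits w) s = (s \in derangements n) && (cyc_word s == w).
Proof.
rewrite inE; apply/forallP/andP => [fits_s|[/forallP der /eqP<-] x]; last first.
  rewrite /fits !nth_cyc_word /= permK; have := der x; rewrite -val_eqE /=.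
  by case: ltngtP.
split.
  apply/forallP=> x; apply: contraTneq (fits_s x) => ->.
  by rewrite /fits ltnn if_same.
apply/eqP/eq_from_tnth=> i; rewrite tnth_mktuple (tnth_nth valley).
have := fits_s (s^-1%g i); have := fits_s i; rewrite /fits permKV.
case: (nth valley w i) => a b /= fits_a fits_b; congr (_, _).
  by case: a fits_a; case: ltngtP.
by case: ifP fits_b => _; case: b; case: ltngtP.
Qed.

Lemma exc_sum_positions n (s : 'S_n) : exc s = (\sum_(a <- cyc_word s) a.1)%N.
Proof.
rewrite /exc -sum1dep_card big_mkcond big_tuple.
by apply: eq_bigr => i _; rewrite tnth_mktuple; case: ifP.
Qed.

Lemma exc_sum_values n (s : 'S_n) : exc s = (\sum_(a <- cyc_word s) a.2)%N.
Proof.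
rewrite exc_sum_positions !big_tuple [RHS](reindex_inj (@perm_inj _ s)).
by apply: eq_bigr => i _; rewrite !tnth_mktuple permK.
Qed.

Lemma cda_cyc_word n (s : 'S_n) :
  (cda s == 0%N) = (double_ascent \notin cyc_word s).
Proof.
rewrite cards_eq0; apply/eqP/idP => [cda0 | no_ascent].
  apply/tnthP=> -[i]; rewrite tnth_mktuple => -[/esym lt_is /esym lt_si].
  by have := in_set0 (s^-1%g i); rewrite -cda0 inE permKV lt_is lt_si.
apply/setP=> i; rewrite !inE; apply: contraNF no_ascent => /andP[lt_is lt_ss].
by apply/tnthP; exists (s i); rewrite tnth_mktuple permK lt_is lt_ss.
Qed.

Lemma exc_addn_double_descents n (s : 'S_n) : cda s = 0%N ->
  n = (2 * exc s + \sum_(a <- cyc_word s) (a == double_descent))%N.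
Proof.
move/eqP; rewrite cda_cyc_word => no_ascent.
rewrite mul2n -addnn {2}exc_sum_values exc_sum_positions -!big_split /=.
rewrite -[LHS](size_tuple (cyc_word s)) -sum1_size.
by apply: eq_big_seq => -[[] []] a_s //; rewrite a_s in no_ascent.
Qed.

Section InversionGeneratingFunctions.

Variables (R : comPzSemiRingType) (q : R).

Implicit Types (B : rel nat).

Definition inv_gf n B : R := \sum_(s : 'S_n | on_board B s) q ^+ invs s.

Lemma eq_inv_gf n B B' : B =2 B' -> inv_gf n B = inv_gf n B'.
Proof.
by move=> eqB; apply: eq_bigl => s; apply: eq_forallb => x; rewrite eqB.
Qed.

Lemma inv_gf_tr n B : inv_gf n B = inv_gf n (fun x y => B y x).
Proof.
rewrite /inv_gf (reindex_inj invg_inj).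
apply: eq_big => s; last by rewrite invsV.
apply/forallP/forallP => Bs x; have := Bs (s x); have := Bs (s^-1%g x).
  by rewrite permK.
by rewrite permKV.
Qed.

Lemma inv_gf_expand_col n (j : 'I_n.+1) B :
  inv_gf n.+1 B = \sum_(i < n.+1 | B i j)
    \sum_(s : 'S_n | on_board (minor i j B) s) q ^+ invs (lift_perm i j s).
Proof.
rewrite /inv_gf (partition_big (fun s : 'S_n.+1 => s^-1%g j) (fun i => B i j)).
  apply: eq_bigr => i Bij.
  under eq_bigl => s do rewrite (canF_eq (permKV s)) [j == _]eq_sym.
  by rewrite big_lift_perm; apply: eq_bigl => s; rewrite on_board_lift_perm Bij.
by move=> s /forallP/(_ (s^-1%g j)); rewrite permKV.
Qed.

Definition qnat n : R := \sum_(i < n) q ^+ i.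

Lemma qnat0 : qnat 0 = 0.
Proof. exact: big_ord0. Qed.

Lemma inv_gf_delete_col n h (j : nat) B :
    (j <= n)%N -> (h <= n.+1)%N ->
    (forall x x' y, (x < h)%N -> (x' < h)%N -> B x y = B x' y) ->
    (forall x y, (x < h)%N -> (y < j)%N -> B x y = false) ->
    (forall x, B x j = (x < h)%N) ->
  inv_gf n.+1 B = q ^+ j * qnat h * inv_gf n (minor 0 j B).
Proof.
rewrite -ltnS => ltjn lehn B_row B_corner B_col.
rewrite (inv_gf_expand_col (Ordinal ltjn)) /= -mulrA mulr_suml mulr_sumr.
under eq_bigl => i do rewrite B_col.
rewrite (big_ord_widen _ (fun i => q ^+ j * (q ^+ i * inv_gf n _)) lehn).
apply: eq_bigr => i ltih.
have -> : inv_gf n (minor 0 j B) = inv_gf n (minor i j B).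
  apply: eq_inv_gf => x y; rewrite /minor /bump leq0n add1n.
  have [lexi|ltix] := leqP i x; first by rewrite add1n.
  by apply: B_row; lia.
rewrite mulrA mulr_sumr; apply: eq_bigr => s /forallP Bs.
rewrite invs_lift_perm_corner ?exprD 1?[_ * q ^+ j]mulrC // => k ltki /=.
rewrite leqNgt; apply: contraL (Bs k) => ltsj.
by rewrite /minor /bump leqNgt ltki leqNgt ltsj B_corner // (ltn_trans ltki).
Qed.

Lemma inv_gf_close_col n r c es : (r <= n.+1)%N -> (c <= n)%N ->
  inv_gf n.+1 (board r c (CloseCol :: es)) =
  q ^+ c * qnat r * inv_gf n (board r.-1 c es).
Proof.
move=> lern lecn; rewrite (@inv_gf_delete_col n r c) //=.
- case: r lern => [|r] _; first by rewrite qnat0 mulr0 !mul0r.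
  congr (_ * _); apply: eq_inv_gf => x y.
  by rewrite /minor eq_sym (negPf (neq_bump _ _)) bumpK board_drop_row.
- by move=> x x' y ltx ltx'; rewrite ltx ltx' (board_open_row _ _ _ ltx ltx').
- by move=> x y ltx lty; rewrite ltn_eqF // unbump_lt // board_corner.
- by move=> x; rewrite eqxx.
Qed.

Lemma inv_gf_close_row n r c es : (r <= n)%N -> (c <= n.+1)%N ->
  inv_gf n.+1 (board r c (CloseRow :: es)) =
  q ^+ r * qnat c * inv_gf n (board r c.-1 es).
Proof.
move=> lern lecn; have gf_tr m r' c' es' :
    inv_gf m (board r' c' es') = inv_gf m (board c' r' (map event_tr es')).
  by rewrite inv_gf_tr; apply: eq_inv_gf => x y; rewrite board_tr.
by rewrite gf_tr inv_gf_close_col // -gf_tr.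
Qed.

Definition history_gf h w : R := inv_gf (h + size w) (board h h (events w)).

Lemma history_gf_valley h w : history_gf h (valley :: w) = history_gf h.+1 w.
Proof. by rewrite /history_gf /= addnS. Qed.

Lemma history_gf_double_ascent h w :
  history_gf h (double_ascent :: w) = q ^+ h * qnat h * history_gf h w.
Proof.
rewrite /history_gf [size _]/= addnS inv_gf_close_col ?leqW ?leq_addr //.
by case: h => [|h]; rewrite // qnat0 mulr0 !mul0r.
Qed.

Lemma history_gf_double_descent h w :
  history_gf h (double_descent :: w) = q ^+ h * qnat h * history_gf h w.
Proof.
rewrite /history_gf [size _]/= addnS inv_gf_close_row ?leqW ?leq_addr //.
by case: h => [|h]; rewrite // qnat0 mulr0 !mul0r.
Qed.

Lemma history_gf_peak h w :
  history_gf h (peak :: w) =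
  q ^+ h * qnat h * (q ^+ h.-1 * qnat h) * history_gf h.-1 w.
Proof.
rewrite /history_gf [size _]/= addnS inv_gf_close_col ?leqW ?leq_addr //.
case: h => [|h]; first by rewrite qnat0 mulr0 !mul0r.
by rewrite addSn inv_gf_close_row ?leq_addr ?ltnS ?mulrA // leq_addr.
Qed.

Definition flip_ascent (a : letter) : letter :=
  if a is double_ascent then double_descent else a.

Lemma history_gf_flip_ascent h w :
  history_gf h (map flip_ascent w) = history_gf h w.
Proof.
elim: w h => [//|[[] []] w IHw] h /=.
- by rewrite history_gf_double_descent history_gf_double_ascent IHw.
- by rewrite !history_gf_valley IHw.
- by rewrite !history_gf_peak IHw.
- by rewrite !history_gf_double_descent IHw.
Qed.

Lemma sum_cyc_word n (f : n.-tuple letter -> R) :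
  \sum_(s in derangements n) q ^+ invs s * f (cyc_word s) =
  \sum_(w : n.-tuple letter) history_gf 0 w * f w.
Proof.
rewrite (partition_big (@cyc_word n) xpredT) //; apply: eq_bigr => w _.
rewrite /history_gf (eq_inv_gf _ (board_events 0 0 w)) size_tuple mulr_suml.
by apply: eq_big => [s | s /andP[_ /eqP->]//]; rewrite on_board_fits.
Qed.

End InversionGeneratingFunctions.

Lemma sum_prod_fiber (R : pzSemiRingType) (I J : finType) (f : I -> J)
    (F : I -> R) n (v : n.-tuple J) :
  \sum_(w : n.-tuple I | map_tuple f w == v) \prod_(i <- w) F i =
  \prod_(j <- v) \sum_(i | f i == j) F i.
Proof.
rewrite [RHS]big_tuple.
rewrite (bigA_distr_big_dep (fun k : 'I_n => [pred i | f i == tnth v k])).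
rewrite (reindex (fun g : {ffun 'I_n -> I} => mktuple g)) /=; last first.
  exists (fun w => [ffun k => tnth w k]) => [g | w] _.
    by apply/ffunP=> k; rewrite ffunE tnth_mktuple.
  by apply: eq_from_tnth => k; rewrite tnth_mktuple ffunE.
apply: eq_big => [g | g _]; last first.
  rewrite (big_tuple _ _ (mktuple g)).
  by apply: eq_bigr => k _; rewrite tnth_mktuple.
apply/eqP/familyP => [<- k | fam_g].
  by rewrite inE tnth_map tnth_mktuple.
by apply: eq_from_tnth => k; rewrite tnth_map tnth_mktuple; apply/eqP/fam_g.
Qed.

Lemma sum_derangements_flip_ascent (R : comPzSemiRingType) (q : R) n
    (F : letter -> R) :
  \sum_(s in derangements n) q ^+ invs s * \prod_(a <- cyc_word s) F a =
  \sum_(s in derangements n)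
    q ^+ invs s * \prod_(b <- cyc_word s) \sum_(a | flip_ascent a == b) F a.
Proof.
rewrite (sum_cyc_word q (fun w : n.-tuple letter => \prod_(a <- w) F a)).
rewrite (sum_cyc_word q (fun w : n.-tuple letter => \prod_(b <- w) _)).
rewrite (partition_big (map_tuple flip_ascent) xpredT) //.
apply: eq_bigr => v _.
rewrite -sum_prod_fiber mulr_sumr; apply: eq_bigr => w /eqP<-.
by rewrite history_gf_flip_ascent.
Qed.

Lemma sum_flip_ascent_fiber (R : pzSemiRingType) (t : R) (b : letter) :
  \sum_(a | flip_ascent a == b) t ^+ a.1 =
  if b == double_ascent then 0 else t ^+ b.1 * (1 + t) ^+ (b == double_descent).
Proof.
case: b => [[] []] /=.
- by rewrite big_pred0 // => -[[] []].
- by rewrite (big_pred1 valley) ?mulr1 // => -[[] []].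
- by rewrite (big_pred1 peak) ?mulr1 // => -[[] []].
rewrite (bigD1 double_ascent) //= (big_pred1 double_descent) => [|[[] []] //].
by rewrite mul1r addrC.
Qed.

Lemma prod_flip_ascent_fiber (R : comPzSemiRingType) (t : R) n (s : 'S_n) :
  \prod_(b <- cyc_word s) \sum_(a | flip_ascent a == b) t ^+ a.1 =
  if cda s == 0%N then t ^+ exc s * (1 + t) ^+ (n - 2 * exc s) else 0.
Proof.
under eq_bigr do rewrite sum_flip_ascent_fiber.
have [cda0 | ] := eqVneq; last first.
  rewrite cda_cyc_word negbK => ascent_s.
  by rewrite (big_rem _ ascent_s) /= mul0r.
have /eqP := cda0; rewrite cda_cyc_word => no_ascent.
have -> : (n - 2 * exc s = \sum_(a <- cyc_word s) (a == double_descent))%N.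
  by have := exc_addn_double_descents cda0; lia.
rewrite exc_sum_positions -!prodrXr -big_split /=.
by apply: eq_big_seq => a; case: eqP => // ->; rewrite (negPf no_ascent).
Qed.

Theorem theorem2 (R : comNzRingType) (q t : R) (n : nat) (hn : (1 <= n)%N) :
  \sum_(s in derangements n) q ^+ invs s * t ^+ exc s =
  \sum_(0 <= k < (n %/ 2).+1)
    (\sum_(s in DE n k) q ^+ invs s) * t ^+ k * (1 + t) ^+ (n - 2 * k).
Proof.
under [LHS]eq_bigr do rewrite exc_sum_positions -prodrXr.
rewrite (sum_derangements_flip_ascent q _ (fun a => t ^+ a.1)).
under [LHS]eq_bigr do rewrite prod_flip_ascent_fiber.
under [RHS]eq_bigr do rewrite -mulrA mulr_suml.
rewrite (exchange_big_dep (mem (derangements n))) /=; last first.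
  by move=> k s _; rewrite inE => /andP[].
apply: eq_bigr => s ds.
under [RHS]eq_bigl => k do rewrite in_set ds /= [exc s == k]eq_sym.
have [cda0 | _] := eqVneq (cda s) 0%N; last first.
  by rewrite mulr0 big_pred0 // => k; rewrite andbF.
under [RHS]eq_bigl do rewrite andbT.
by rewrite big_nat1_eq ifT //; have := exc_addn_double_descents cda0; lia.
Qed.
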